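(* For all integers $n\geq 2$ and $q\geq 3$, the Bose-Mesner algebra of the Hamming scheme $\mathcal{H}(n,q)$ is not the Nomura algebra of a type II matrix; that is, there is no type II matrix $W$ (of size $q^n\times q^n$) such that $\mathcal{N}_W$ equals the Bose-Mesner algebra of $\mathcal{H}(n,q)$.
   Context: All matrices are over $\mathbb{C}$; $I_q$ and $J_q$ denote the $q\times q$ identity and all-ones matrices, and $\otimes$ is the Kronecker product. The Bose-Mesner algebra of an association scheme is the complex span of its matrices. Hamming scheme: let $A_0=I_q$, $A_1=J_q-I_q$ (the trivial association scheme on $q$ vertices). The symmetric group $\mathcal{S}_n$ acts on the span of $\{A_{i_1}\otimes\cdots\otimes A_{i_n}: i_1,\ldots,i_n\in\{0,1\}\}$ by linear extension of $(A_{i_1}\otimes\cdots\otimes A_{i_n})^\sigma=A_{i_{1\sigma^{-1}}}\otimes\cdots\otimes A_{i_{n\sigma^{-1}}}$. The set of matrices in this span fixed by every $\sigma\in\mathcal{S}_n$ is the Bose-Mesner algebra of an association scheme on $q^n$ vertices, the Hamming scheme $\mathcal{H}(n,q)$. A $v\times v$ matrix $W$ with no zero entries is a type II matrix if $\sum_{x=1}^v \frac{W(x,a)}{W(x,b)}=\delta_{a,b}v$ for all $a,b=1,\ldots,v$. For such $W$ and $a,b\in\{1,\ldots,v\}$, let $Y_{a,b}\in\mathbb{C}^v$ be the vector with entries $Y_{a,b}(x)=W(x,a)/W(x,b)$. The Nomura algebra $\mathcal{N}_W$ is the set of all $v\times v$ complex matrices $M$ such that every $Y_{a,b}$ is an eigenvector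 of $M$. *)

(* Defs.v *)
From HB Require Import structures.
From mathcomp Require Import all_boot all_order all_algebra all_fingroup.
From mathcomp Require Import classical_sets reals complex mxtens.

Set Implicit Arguments.
Unset Strict Implicit.
Unset Printing Implicit Defensive.

Import GRing.Theory.
Local Open Scope classical_set_scope.
Local Open Scope ring_scope.

Section TypeII.
Variables (F : fieldType) (v : nat).
Implicit Types (W M : 'M[F]_v) (y : 'cV[F]_v).

Definition type_II W : Prop :=
  (forall x a, W x a != 0) /\
  (forall a b, \sum_(x < v) W x a / W x b = (a == b)%:R * v%:R).

Definition nomura_vector W (a b : 'I_v) : 'cV[F]_v :=
  \col_(x < v) (W x a / W x b).

(* MathComp's [eigenvalue] and [eigenspace] concern the action on row vectors,
   whereas Nomura vectors are eigenvectors for the action on columns. *)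
Definition eigenvector M y : Prop :=
  y != 0 /\ exists lambda : F, M *m y = lambda *: y.

Definition nomura_algebra W : set 'M[F]_v :=
  [set M | forall a b, eigenvector M (nomura_vector W a b)].

End TypeII.

Section Hamming.
Variables (F : fieldType) (q : nat).

Definition trivial_scheme (i : 'I_2) : 'M[F]_q :=
  if i == 0 then 1%:M else const_mx 1 - 1%:M.

(* The iterated Kronecker product [A 0 *t A 1 *t ... *t A (n - 1)], cast along
   [q ^ n.+1 = q * q ^ n]. *)
Fixpoint kron n : ('I_n -> 'M[F]_q) -> 'M[F]_(q ^ n) :=
  match n with
  | 0 => fun=> 1%:M
  | n'.+1 => fun A =>
      castmx (esym (expnS q n'), esym (expnS q n'))
        (A ord0 *t kron (fun k => A (lift ord0 k)))
  end.

Variable n : nat.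

Definition scheme_tensor (i : {ffun 'I_n -> 'I_2}) : 'M[F]_(q ^ n) :=
  kron (fun k => trivial_scheme (i k)).

Definition scheme_tensors :
    #|{: {ffun 'I_n -> 'I_2}}|.-tuple 'M[F]_(q ^ n) :=
  [tuple scheme_tensor (enum_val r) | r < #|{: {ffun 'I_n -> 'I_2}}|].

(* Permutations act on the right in MathComp too ([(s * t) k = t (s k)]), so
   the index i_{k sigma^-1} is [i (s^-1 k)]. *)
Definition permute_word (s : 'S_n) (i : {ffun 'I_n -> 'I_2}) :
    {ffun 'I_n -> 'I_2} :=
  [ffun k => i ((s^-1)%g k)].

(* The linear extension of [scheme_tensor i |-> scheme_tensor (permute_word s i)]
   from the tensors to their span; they form a free family when [1 < q], see
   [scheme_tensors_free] and [sym_actE]. *)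
Definition sym_act (s : 'S_n) (M : 'M[F]_(q ^ n)) : 'M[F]_(q ^ n) :=
  \sum_(i : {ffun 'I_n -> 'I_2})
    coord scheme_tensors (enum_rank i) M *: scheme_tensor (permute_word s i).

Definition hamming_bose_mesner : set 'M[F]_(q ^ n) :=
  [set M | M \in <<scheme_tensors>>%VS /\ forall s : 'S_n, sym_act s M = M].

End Hamming.

Arguments hamming_bose_mesner F q n : clear implicits.

Section HammingFacts.
Variables (F : fieldType) (q : nat).

Fixpoint word_index n : ('I_n -> 'I_q) -> 'I_(q ^ n) :=
  match n with
  | 0 => fun=> Ordinal (ltn0Sn 0)
  | n'.+1 => fun x =>
      cast_ord (esym (expnS q n'))
        (mxtens_index (x ord0, word_index (fun k => x (lift ord0 k))))
  end.

Lemma kronE n (A : 'I_n -> 'M[F]_q) (x y : 'I_n -> 'I_q) :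
  kron A (word_index x) (word_index y) = \prod_(k < n) A k (x k) (y k).
Proof.
elim: n A x y => [|n IHn] A x y.
  by rewrite big_ord0 /= mxE eqxx.
by rewrite big_ord_recl /= castmxE /= !cast_ordK tensmxE IHn.
Qed.

Lemma scheme_tensors_nth n (r : 'I_#|{: {ffun 'I_n -> 'I_2}}|) :
  (scheme_tensors F q n)`_r = scheme_tensor F q (enum_val r).
Proof. by rewrite -tnth_nth tnth_mktuple. Qed.

Lemma scheme_tensors_free n (q_gt1 : (1 < q)%N) : free (scheme_tensors F q n).
Proof.
apply/freeP => c /matrixP c0 r.
pose i := enum_val r.
pose x (k : 'I_n) : 'I_q := Ordinal (ltnW q_gt1).
pose y (k : 'I_n) : 'I_q := widen_ord q_gt1 (i k).
have := c0 (word_index x) (word_index y).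
rewrite summxE [RHS]mxE (bigD1 r) // big1 ?addr0 => [|r' neq_r].
  rewrite mxE scheme_tensors_nth kronE big1 ?mulr1 /=; first by rewrite addr0.
  move=> k _.
  rewrite /trivial_scheme -/i -val_eqE; case: ifP => [ik0|ik0].
    by rewrite mxE -val_eqE /= eq_sym ik0.
  by rewrite !mxE -val_eqE /= eq_sym ik0 subr0.
rewrite mxE scheme_tensors_nth kronE.
have [k neq_k] : exists k, enum_val r' k != i k.
  apply/existsP; rewrite -negb_forall; apply: contra neq_r => /forallP eq_k.
  by apply/eqP/enum_val_inj/ffunP => k; apply/eqP.
apply/eqP; rewrite mulf_eq0; apply/orP; right; apply/prodf_eq0.
exists k => //; move: neq_k; rewrite /trivial_scheme /y.
case: (enum_val r' k) => [[|[|//]] l]; case: (i k) => [[|[|//]] l'] //= _.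
  by rewrite mxE.
by rewrite !mxE subrr.
Qed.

Lemma sym_actE n (q_gt1 : (1 < q)%N) (s : 'S_n) (i : {ffun 'I_n -> 'I_2}) :
  sym_act s (scheme_tensor F q i) = scheme_tensor F q (permute_word s i).
Proof.
have <- : (scheme_tensors F q n)`_(enum_rank i) = scheme_tensor F q i.
  by rewrite scheme_tensors_nth enum_rankK.
rewrite /sym_act (bigD1 i) //= coord_free ?scheme_tensors_free // eqxx scale1r.
rewrite big1 ?addr0 // => j neq_ji.
rewrite coord_free ?scheme_tensors_free //.
by rewrite (inj_eq enum_rank_inj) eq_sym (negPf neq_ji) scale0r.
Qed.

End HammingFacts.

(* Main.v *)
Require Import Defs.
From mathcomp Require Import all_boot all_order all_algebra all_fingroup.
From mathcomp Require Import classical_sets reals complex mxtens ring.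

Set Implicit Arguments.
Unset Strict Implicit.
Unset Printing Implicit Defensive.

Import GRing.Theory Num.Theory.
Local Open Scope ring_scope.

(** Index the rows of [W] by the words [x] of length [n] over [q] letters, and
    let [ratio a b x = W x a / W x b].  Let [proj k] be the projection onto the
    zero-sum functions of the letter [x k] alone, and [E1 = \sum_k proj k].  The
    entries of [E1] depend on the Hamming distance only, so [E1] belongs to the
    Bose-Mesner algebra; those of [proj k] depend on the position [k], so
    [proj k] does not, as [n >= 2].  It is therefore enough to show that if
    every [ratio a b] is an eigenvector of [E1], then it is one of every [proj k]: a
    Nomura algebra that contains [E1] contains more than the Hamming scheme.

    Since [E1] is idempotent, [ratio a b] lies in its kernel, which every
    [proj k] annihilates, or in its image.  In the second case the symmetry of
    [E1] puts the reciprocal [ratio b a] in the image as well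
    ([E1_ratio_inv]).  So [f = ratio a b] and [1 / f] are both sums of zero-sum
    functions of single letters.  An elementary computation on the values of
    such an [f] shows that it depends on one letter only, and is then fixed by
    one of the [proj k] and killed by the others, or else that it has the form
    [f = fk + fl], with [fk] and [fl] functions of the letters at [k] and [l]
    whose squares are nonzero constants ([reciprocal_two_letters]).

    The second form is impossible when [q >= 3].  The product of [f] and
    [fk - fl] is constant, and testing the eigenvector [ratio b c = ratio a c / f]
    against functions of the letter at [k] shows that [proj k (ratio a c)] is
    proportional to [fk], for every [c] ([proj_ratio_prop]).  But the vectors
    [ratio a c] span all functions, so [proj k] would have rank one, whereas the
    zero-sum functions of one letter form a space of dimension [q - 1]
    ([ratio_one_letter]). *)

(** * Functions of one letter on words *)

Section Words.
Variables (F : numFieldType) (n q : nat).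
Hypothesis q_gt0 : (0 < q)%N.

Local Notation word := {ffun 'I_n -> 'I_q}.
Implicit Types (phi psi : word -> F) (u w : 'I_q -> F) (k l m : 'I_n).
Implicit Types (x y z : word) (s t : 'I_q).

Let q_neq0 : q%:R != 0 :> F.
Proof. by rewrite pnatr_eq0 -lt0n. Qed.

Let qn_neq0 : (q ^ n)%:R != 0 :> F.
Proof. by rewrite pnatr_eq0 -lt0n expn_gt0 q_gt0. Qed.

Definition avg u : F := q%:R^-1 * \sum_t u t.
Definition mean phi : F := (q ^ n)%:R^-1 * \sum_x phi x.

Lemma eq_mean phi psi : phi =1 psi -> mean phi = mean psi.
Proof. by move=> e; rewrite /mean (eq_bigr _ (fun x _ => e x)). Qed.

Lemma meanD phi psi : mean (fun x => phi x + psi x) = mean phi + mean psi.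
Proof. by rewrite /mean big_split mulrDr. Qed.

Lemma meanZ (a : F) phi : mean (fun x => a * phi x) = a * mean phi.
Proof. by rewrite /mean -mulr_sumr mulrCA. Qed.

Lemma mean_sum (I : finType) (P : pred I) (phi : I -> word -> F) :
  mean (fun x => \sum_(i | P i) phi i x) = \sum_(i | P i) mean (phi i).
Proof. by rewrite /mean exchange_big mulr_sumr. Qed.

Lemma mean_cst (a : F) : mean (fun=> a) = a.
Proof.
by rewrite /mean sumr_const card_ffun !card_ord -[a *+ _]mulr_natl mulKf.
Qed.

Lemma avg_cst (a : F) : avg (fun=> a) = a.
Proof. by rewrite /avg sumr_const card_ord -[a *+ _]mulr_natl mulKf. Qed.

Definition set_letter x k t : word := [ffun j => if j == k then t else x j].

Definition free_of k phi : Prop :=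
  forall x t, phi (set_letter x k t) = phi x.

Lemma free_of_letter u k l : l != k -> free_of k (fun x => u (x l)).
Proof. by move=> lk x t; rewrite ffunE (negPf lk). Qed.

(** The involution exchanging the letter of [x] at [k] with [t] shows that
    averaging over words is averaging over the letter at [k] first. *)
Lemma mean_set_letter k phi :
  mean phi = mean (fun x => avg (fun t => phi (set_letter x k t))).
Proof.
rewrite /mean; congr (_ * _); rewrite /avg -mulr_sumr pair_bigA /=.
pose h (p : word * 'I_q) := (set_letter p.1 k p.2, p.1 k).
have hK : involutive h.
  case=> x t; rewrite /h /=; congr (_, _); last by rewrite ffunE eqxx.
  by apply/ffunP => j; rewrite !ffunE; case: eqP => // ->.
rewrite [in RHS](reindex_inj (inv_inj hK)) /=.
under [in RHS]eq_bigr => p _.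
  have -> : set_letter (set_letter p.1 k p.2) k (p.1 k) = p.1.
    by have := hK p => /(congr1 fst).
  over.
rewrite -(pair_bigA _ (fun x (_ : 'I_q) => phi x)) /=.
under [in RHS]eq_bigr => x _ do rewrite sumr_const card_ord -mulr_natl.
by rewrite -mulr_sumr mulKf.
Qed.

(** A letter and a function that ignores it are independent under the uniform
    measure on words. *)
Lemma mean_indep k u phi :
  free_of k phi -> mean (fun x => u (x k) * phi x) = avg u * mean phi.
Proof.
move=> phik; rewrite (mean_set_letter k) -meanZ; apply: eq_mean => x.
rewrite /avg -mulrA mulr_suml; congr (_ * _); apply: eq_bigr => t _.
by rewrite phik ffunE eqxx.
Qed.

Lemma mean_letter k u : mean (fun x => u (x k)) = avg u.
Proof.
rewrite -[RHS]mulr1 -(mean_cst 1) -(@mean_indep k u (fun=> 1)) //.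
by apply: eq_mean => x; rewrite mulr1.
Qed.

(** Up to a factor, the projection of the indicator of [t] onto the zero-sum
    functions of a letter: hence the kernel of that projection
    ([avg_mul_dev]). *)
Definition dev t s : F := q%:R * (s == t)%:R - 1.

Lemma avg_mul_dev t u : avg (fun s => u s * dev t s) = u t - avg u.
Proof.
rewrite /avg; apply: (mulfI q_neq0); rewrite mulrBr !mulVKf //.
under eq_bigr => s _ do rewrite /dev mulrBr mulr1 mulrCA.
rewrite sumrB -mulr_sumr; congr (_ * _ - _).
rewrite (bigD1 t) //= eqxx mulr1 big1 ?addr0 // => s /negPf ->.
by rewrite mulr0.
Qed.

Lemma avg_dev t : avg (dev t) = 0.
Proof.
have := avg_mul_dev t (fun=> 1); rewrite avg_cst subrr => <-.
by rewrite /avg; congr (_ * _); apply: eq_bigr => s _; rewrite mul1r.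
Qed.

(** The component of [phi] in the space of the zero-sum functions of the letter
    at [k] alone. *)
Definition proj k phi t : F := mean (fun x => phi x * dev t (x k)).

(** The projection onto the sum of these spaces over all [k], which is the
    first nontrivial eigenspace of the Hamming scheme. *)
Definition E1 phi x : F := \sum_k proj k phi (x k).

Lemma eq_proj k phi psi : phi =1 psi -> proj k phi =1 proj k psi.
Proof. by move=> e t; apply: eq_mean => x; rewrite e. Qed.

Lemma eq_E1 phi psi : phi =1 psi -> E1 phi =1 E1 psi.
Proof. by move=> e x; apply: eq_bigr => k _; apply: eq_proj. Qed.

Lemma projD k phi psi t :
  proj k (fun x => phi x + psi x) t = proj k phi t + proj k psi t.
Proof. by rewrite -meanD; apply: eq_mean => x; rewrite mulrDl. Qed.

Lemma projZ k a phi t : proj k (fun x => a * phi x) t = a * proj k phi t.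
Proof. by rewrite -meanZ; apply: eq_mean => x; rewrite mulrA. Qed.

Lemma E1D phi psi x : E1 (fun x => phi x + psi x) x = E1 phi x + E1 psi x.
Proof. by rewrite -big_split; apply: eq_bigr => k _; rewrite projD. Qed.

Lemma avg_proj k phi : avg (proj k phi) = 0.
Proof.
have dev0 s : \sum_t dev t s = 0.
  have /eqP := avg_dev s; rewrite mulf_eq0 invr_eq0 (negPf q_neq0) /= => /eqP e.
  by rewrite -[RHS]e; apply: eq_bigr => t _; rewrite /dev eq_sym.
rewrite /avg /proj /mean -mulr_sumr exchange_big big1 ?mulr0 // => x _.
by rewrite -mulr_sumr dev0 mulr0.
Qed.

Lemma proj_free k phi t : free_of k phi -> proj k phi t = 0.
Proof.
move=> phik; rewrite /proj.
under eq_mean => x do rewrite mulrC.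
by rewrite mean_indep // avg_dev mul0r.
Qed.

Lemma proj_letter k u t : proj k (fun x => u (x k)) t = u t - avg u.
Proof.
by rewrite /proj (mean_letter k (fun s => u s * dev t s)) avg_mul_dev.
Qed.

Lemma proj_E1 k phi t : proj k (E1 phi) t = proj k phi t.
Proof.
rewrite {1}/proj /E1; under eq_mean => x do rewrite mulr_suml.
rewrite mean_sum (bigD1 k) //= big1 => [|l lk]; last first.
  exact: (proj_free _ (free_of_letter _ lk)).
by rewrite addr0 [LHS]proj_letter avg_proj subr0.
Qed.

Lemma E1_idem phi : E1 (E1 phi) =1 E1 phi.
Proof. by move=> x; apply: eq_bigr => k _; rewrite proj_E1. Qed.

Lemma mean_E1 phi : mean (E1 phi) = 0.
Proof.
by rewrite mean_sum big1 // => k _; rewrite mean_letter avg_proj.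
Qed.

(** The kernel [dev (y k) (x k)] is symmetric in [x] and [y]. *)
Lemma E1_sym phi psi :
  mean (fun x => E1 phi x * psi x) = mean (fun x => phi x * E1 psi x).
Proof.
under eq_mean => x do rewrite mulr_suml.
under [RHS]eq_mean => x do rewrite mulr_sumr.
rewrite !mean_sum; apply: eq_bigr => k _; rewrite /mean; congr (_ * _).
rewrite /proj /mean.
under eq_bigr => x _ do rewrite -mulrA mulr_suml mulr_sumr.
under [RHS]eq_bigr => x _ do rewrite mulr_sumr mulr_sumr.
rewrite exchange_big; apply: eq_bigr => x _; apply: eq_bigr => y _ /=.
rewrite /dev [x k == y k]eq_sym; ring.
Qed.

Lemma E1_letter k u x : E1 (fun x => u (x k)) x = u (x k) - avg u.
Proof.
rewrite /E1 (bigD1 k) //= proj_letter big1 ?addr0 // => l lk.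
by apply: proj_free; apply: free_of_letter; rewrite eq_sym.
Qed.

Lemma E1_letters k l u w x : k != l -> avg w = 0 ->
  E1 (fun x => u (x k) * w (x l)) x = avg u * w (x l).
Proof.
move=> kl w0; rewrite /E1 (bigD1 l) //= big1 ?addr0 => [|m ml].
  rewrite -[w (x l)]subr0 -w0 -(proj_letter l) -projZ /proj.
  under eq_mean => y do rewrite -mulrA.
  rewrite (mean_indep u); last first.
    by move=> y t; rewrite !ffunE ![l == k]eq_sym (negPf kl).
  by rewrite -meanZ; apply: eq_mean => y; rewrite mulrA.
have [->|mk] := eqVneq m k; last first.
  apply: proj_free => y t.
  by rewrite !ffunE ![_ == m]eq_sym (negPf ml) (negPf mk).
rewrite /proj.
under eq_mean => y do rewrite mulrAC mulrC.
rewrite (mean_indep w); first by rewrite w0 mul0r.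
by move=> y t; rewrite !ffunE (negPf kl).
Qed.


(** * Reciprocal pairs in the image of E1 *)

Lemma avg0_neq u t0 : avg u = 0 -> u t0 != 0 -> exists t1, u t0 != u t1.
Proof.
move=> u0 ut0; apply/existsP; apply: contraNT ut0; rewrite negb_exists.
move=> /forallP ucst; rewrite -u0 eq_sym.
suff -> : avg u = avg (fun=> u t0) by rewrite avg_cst.
rewrite /avg; congr (_ * _); apply: eq_bigr => t _.
by apply/esym/eqP; have := ucst t; rewrite negbK.
Qed.

(** From [1 / (a + c) - 1 / (a + d) = 1 / (b + c) - 1 / (b + d)] and [c != d],
    clearing denominators gives [(a + c) * (a + d) = (b + c) * (b + d)], whose
    two sides differ by [(a - b) * (a + b + c + d)]. *)
Lemma reciprocal_grid (a b c d a' b' c' d' : F) :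
    (a + c) * (a' + c') = 1 -> (a + d) * (a' + d') = 1 ->
    (b + c) * (b' + c') = 1 -> (b + d) * (b' + d') = 1 ->
  a != b -> c != d -> a + b + c + d = 0.
Proof.
move=> ac ad bc bd ab cd.
have ea : (a + c) * (a + d) * (c' - d') = d - c.
  transitivity ((a + d) * ((a + c) * (a' + c'))
    - (a + c) * ((a + d) * (a' + d'))).
    by ring.
  by rewrite ac ad; ring.
have eb : (b + c) * (b + d) * (c' - d') = d - c.
  transitivity ((b + d) * ((b + c) * (b' + c'))
    - (b + c) * ((b + d) * (b' + d'))).
    by ring.
  by rewrite bc bd; ring.
have cd' : c' - d' != 0.
  apply: contraNneq cd => e.
  by move: ea; rewrite e mulr0 => /esym/eqP; rewrite subr_eq0 eq_sym.
have /eqP := mulIf cd' (etrans ea (esym eb)).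
rewrite -subr_eq0 (_ : _ - _ = (a - b) * (a + b + c + d)); last by ring.
by rewrite mulf_eq0 subr_eq0 (negPf ab) => /eqP.
Qed.

Definition rest k l phi x : F :=
  \sum_(m | (m != k) && (m != l)) proj m phi (x m).

Lemma E1_split k l phi x : k != l ->
  E1 phi x = proj k phi (x k) + proj l phi (x l) + rest k l phi x.
Proof. by move=> kl; rewrite /E1 (bigD1 k) // (bigD1 l) 1?eq_sym //= addrA. Qed.

Lemma E1_grid k l phi x t s : k != l -> E1 phi =1 phi ->
  phi (set_letter (set_letter x k t) l s) =
    proj k phi t + proj l phi s + rest k l phi x.
Proof.
move=> kl e; rewrite -e (E1_split _ _ kl) !ffunE eqxx (negPf kl) eqxx.
congr (_ + _); apply: eq_bigr => m /andP[mk ml].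
by rewrite !ffunE (negPf mk) (negPf ml).
Qed.

Lemma mean_rest k l phi : mean (rest k l phi) = 0.
Proof. by rewrite mean_sum big1 // => m _; rewrite mean_letter avg_proj. Qed.

(** Suppose that [f] and its reciprocal [g] lie in the image of [E1] and that
    [f] depends on the letters at [k] and [l].  Vary these two letters only:
    [reciprocal_grid] says that two distinct values of [fk], two distinct values
    of [fl] and twice the contribution of the other letters add up to [0].
    Hence the latter is constant, thus [0] as its mean is; moreover [fk] takes
    only two values [a] and [b], and [fl] only two values.  Then the product of
    [f] and [fk - fl - (a + b)] is constant, so the latter is a multiple of [g]
    and has mean [0], as [fk] and [fl] have: this forces [a + b = 0]. *)
Lemma reciprocal_two_letters f g k l t0 s0 :
    E1 f =1 f -> E1 g =1 g -> (forall x, f x * g x = 1) -> k != l ->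
    proj k f t0 != 0 -> proj l f s0 != 0 ->
  exists al ga : F, [/\ al != 0, ga != 0,
    (forall t, proj k f t ^+ 2 = al) /\ (forall s, proj l f s ^+ 2 = ga) &
    forall x, f x = proj k f (x k) + proj l f (x l)].
Proof.
move=> fE gE fg kl ft0 fs0.
have [t1 ft1] := avg0_neq (avg_proj k f) ft0.
have [s1 fs1] := avg0_neq (avg_proj l f) fs0.
set a := proj k f t0 in ft0 ft1; set b := proj k f t1 in ft1.
set c := proj l f s0 in fs0 fs1; set d := proj l f s1 in fs1.
have grid t t' s s' x :
    proj k f t != proj k f t' -> proj l f s != proj l f s' ->
    proj k f t + proj k f t' + proj l f s + proj l f s' + 2 * rest k l f x = 0.
  move=> tt' ss'.
  have pt r r' : (proj k f r + (proj l f r' + rest k l f x)) *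
                 (proj k g r + (proj l g r' + rest k l g x)) = 1.
    by rewrite !addrA -!E1_grid.
  rewrite -(reciprocal_grid (pt t s) (pt t s') (pt t' s) (pt t' s')) //.
    by ring.
  by rewrite (inj_eq (addIr _)).
have two0 : 2%:R != 0 :> F by rewrite pnatr_eq0.
have restE x : rest k l f x = - (a + b + c + d) / 2%:R.
  have := grid t0 t1 s0 s1 x ft1 fs1; rewrite -/a -/b -/c -/d => e.
  apply: (mulIf two0); rewrite divfK //; apply/eqP; rewrite -addr_eq0.
  by apply/eqP; rewrite -e; ring.
have sum0 : a + b + c + d = 0.
  have := mean_rest k l f; rewrite (eq_mean restE) mean_cst => /eqP.
  by rewrite mulf_eq0 invr_eq0 (negPf two0) orbF oppr_eq0 => /eqP.
have rest0 x : rest k l f x = 0 by rewrite restE sum0 oppr0 mul0r.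
have f2 x : f x = proj k f (x k) + proj l f (x l).
  by rewrite -fE (E1_split _ _ kl) rest0 addr0.
have x0 : word := [ffun=> t0].
have fk t : (proj k f t - a) * (proj k f t - b) = 0.
  have [->|ta] := eqVneq (proj k f t) a; first by rewrite subrr mul0r.
  have := grid t t0 s0 s1 x0 ta fs1; rewrite rest0 mulr0 addr0 -/a -/c -/d => e.
  suff -> : proj k f t = b by rewrite subrr mulr0.
  apply/eqP; rewrite -subr_eq0; apply/eqP.
  transitivity (proj k f t + a + c + d - (a + b + c + d)); first by ring.
  by rewrite e sum0 subrr.
have fl s : (proj l f s - c) * (proj l f s - d) = 0.
  have [->|sc] := eqVneq (proj l f s) c; first by rewrite subrr mul0r.
  have := grid t0 t1 s s0 x0 ft1 sc; rewrite rest0 mulr0 addr0 -/a -/b -/c => e.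
  suff -> : proj l f s = d by rewrite subrr mulr0.
  apply/eqP; rewrite -subr_eq0; apply/eqP.
  transitivity (a + b + proj l f s + c - (a + b + c + d)); first by ring.
  by rewrite e sum0 subrr.
pose S := a + b.
have cdS : c + d = - S.
  by apply/eqP; rewrite -addr_eq0 /S addrC addrA sum0.
(* [fk] and [- fl] are roots of quadratics with the same sum of roots [S]. *)
have key x : f x * (proj k f (x k) - proj l f (x l) - S) = c * d - a * b.
  rewrite f2; transitivity ((proj k f (x k) - a) * (proj k f (x k) - b)
    - (proj l f (x l) - c) * (proj l f (x l) - d)
    - (c + d + S) * proj l f (x l)
    + c * d - a * b); first by rewrite /S; ring.
  by rewrite fk fl cdS addNr mul0r !subr0 add0r.
have kg x : proj k f (x k) - proj l f (x l) - S = (c * d - a * b) * g x.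
  by rewrite -(key x) mulrAC fg mul1r.
have S0 : S = 0.
  have mS : mean (fun x => proj k f (x k) - proj l f (x l) - S) = - S.
    transitivity (mean (fun x => proj k f (x k))
      + -1 * mean (fun x => proj l f (x l)) + mean (fun=> - S)).
      by rewrite -meanZ -!meanD; apply: eq_mean => x; rewrite mulN1r.
    by rewrite !mean_letter !avg_proj mean_cst mulr0 !add0r.
  apply/eqP; rewrite -oppr_eq0 -mS (eq_mean kg) meanZ -(eq_mean gE) mean_E1.
  by rewrite mulr0.
have bE : b = - a by apply/eqP; rewrite -addr_eq0 addrC -/S S0.
have dE : d = - c by apply/eqP; rewrite -addr_eq0 addrC cdS S0 oppr0.
exists (a ^+ 2), (c ^+ 2); split.
- by rewrite expf_neq0.
- by rewrite expf_neq0.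
- split=> [t|s].
    by have := fk t; rewrite bE opprK -subr_sqr => /eqP; rewrite subr_eq0 => /eqP.
  by have := fl s; rewrite dE opprK -subr_sqr => /eqP; rewrite subr_eq0 => /eqP.
- exact: f2.
Qed.


(** * Type II matrices with rows indexed by words *)

Section TypeIIWords.
Variables (I : finType) (W : word -> I -> F).
Hypothesis W_neq0 : forall x a, W x a != 0.
Hypothesis W_cols : forall a b, mean (fun x => W x a / W x b) = (a == b)%:R.
Hypothesis W_rows :
  forall x y, \sum_a W x a / W y a = (x == y)%:R * (q ^ n)%:R.

Definition ratio a b x : F := W x a / W x b.

Hypothesis ratio_eig : forall a b, exists lambda, forall x,
  E1 (ratio a b) x = lambda * ratio a b x.

Lemma ratio_neq0 a b x : ratio a b x != 0.
Proof. by rewrite mulf_neq0 // invr_eq0. Qed.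

Lemma ratioM a b c x : ratio a b x * ratio b c x = ratio a c x.
Proof. by rewrite /ratio mulrA divfK. Qed.

Lemma ratioaa a x : ratio a a x = 1.
Proof. exact: divff. Qed.

Lemma proj_eq0 k phi t : E1 phi =1 (fun=> 0) -> proj k phi t = 0.
Proof. by move=> e; rewrite -proj_E1 (eq_proj _ e) proj_free. Qed.

Lemma E1_ratio a b : E1 (ratio a b) =1 ratio a b \/ E1 (ratio a b) =1 (fun=> 0).
Proof.
have [la e] := ratio_eig a b.
have t0 : 'I_q := Ordinal q_gt0.
pose x0 : word := [ffun=> t0].
have : la * la * ratio a b x0 = la * ratio a b x0.
  rewrite -mulrA -e -[RHS]E1_idem (eq_E1 e) /E1 mulr_sumr.
  by apply: eq_bigr => k _; rewrite projZ.
move=> /(mulIf (ratio_neq0 a b x0)) /eqP; rewrite -subr_eq0 -[X in _ - X]mulr1.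
rewrite -mulrBr mulf_eq0 subr_eq0 => /orP[]/eqP la01.
  by right=> x; rewrite e la01 mul0r.
by left=> x; rewrite e la01 mul1r.
Qed.

(** The bilinear form [mean (phi * psi)] takes the value [1] at [ratio a b] and
    its reciprocal, but it vanishes between the image and the kernel of the
    symmetric operator [E1]. *)
Lemma E1_ratio_inv a b :
  E1 (ratio a b) =1 ratio a b -> E1 (ratio b a) =1 ratio b a.
Proof.
move=> eab; case: (E1_ratio b a) => // eba; exfalso.
have := E1_sym (ratio a b) (ratio b a).
rewrite (@eq_mean _ (fun=> 1)) ?mean_cst => [|x]; last first.
  by rewrite eab ratioM ratioaa.
rewrite (@eq_mean _ (fun=> 0)) ?mean_cst => [|x]; last by rewrite eba mulr0.
by move/eqP; rewrite oner_eq0.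
Qed.

(** With [f = ratio a b = fk + fl], [h = ratio a c] and [p = ratio b c = h / f],
    [fk ^ 2 = al] and [fl ^ 2 = ga], so that [(al - ga) * p = h * (fk - fl)],
    and [E1 p] is [p] or [0].
    Pairing [(al - ga) * f * E1 p] with [dev t] at the letter [k] gives a multiple of
    [proj k h t], and moving [E1] to the other side by symmetry gives
    [al * proj k h t] up to a multiple of [fk t].  The two multiples of
    [proj k h t] differ, by [ga] if [E1 p = p] and by [al] if [E1 p = 0], so
    [proj k h] is proportional to [fk]. *)
Lemma proj_ratio_prop a b k l t0 s0 : E1 (ratio a b) =1 ratio a b -> k != l ->
    proj k (ratio a b) t0 != 0 -> proj l (ratio a b) s0 != 0 ->
  forall c, exists r, forall t, proj k (ratio a c) t = r * proj k (ratio a b) t.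
Proof.
move=> fE kl fk0 fl0 c.
have [al [ga [al0 ga0 [fk2 fl2] f2]]] :=
  reciprocal_two_letters fE (E1_ratio_inv fE)
  (fun x => etrans (ratioM a b a x) (ratioaa a x)) kl fk0 fl0.
have [hE|h0] := E1_ratio a c; last first.
  by exists 0 => t; rewrite mul0r proj_eq0.
have [->|cb] := eqVneq c b; first by exists 1 => t; rewrite mul1r.
set h := ratio a c in hE *; set f := ratio a b in fE fk0 fl0 fk2 fl2 f2 *.
pose p := ratio b c; pose fk := proj k f; pose fl := proj l f.
have fp x : f x * p x = h x by exact: ratioM.
pose r := mean (fun x => h x * fl (x l)).
(* This is where [c != b] matters: distinct columns are orthogonal. *)
have mean_p : mean p = 0 by rewrite /p W_cols eq_sym (negPf cb).
have pE x : (al - ga) * p x = h x * (fk (x k) - fl (x l)).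
  by rewrite -(fk2 (x k)) -(fl2 (x l)) subr_sqr mulrC -fp f2 /fk /fl; ring.
have hfl t : mean (fun x => h x * ((fk (x k) * dev t (x k)) * fl (x l))) =
    fk t * r.
  transitivity (mean (fun x => E1 h x * ((fk (x k) * dev t (x k)) * fl (x l)))).
    by apply: eq_mean => x; rewrite hE.
  rewrite E1_sym -meanZ; apply: eq_mean => x.
  rewrite (E1_letters (fun s => fk s * dev t s)) ?avg_proj //.
  by rewrite avg_mul_dev avg_proj subr0 mulrCA.
have side t : (al - ga) * mean (fun x => p x * (fk (x k) * dev t (x k))) =
    al * proj k h t - fk t * r.
  transitivity (mean (fun x => al * (h x * dev t (x k))
    + -1 * (h x * ((fk (x k) * dev t (x k)) * fl (x l))))).
    rewrite -meanZ; apply: eq_mean => x.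
    by rewrite mulrA pE -(fk2 (x k)) /fk /fl; ring.
  by rewrite meanD !meanZ hfl mulN1r.
have E1fd t x :
    E1 (fun y => f y * dev t (y k)) x = fk (x k) * dev t (x k) - fk t.
  rewrite (@eq_E1 _ (fun y => fk (y k) * dev t (y k) + dev t (y k) * fl (y l))).
    rewrite E1D (E1_letter k (fun s => fk s * dev t s)) E1_letters ?avg_proj //.
    by rewrite avg_dev mul0r addr0 avg_mul_dev avg_proj subr0.
  by move=> y; rewrite f2 mulrDl [X in _ + X]mulrC.
have main t : (al - ga) * mean (fun x => E1 p x * (f x * dev t (x k))) =
    al * proj k h t - fk t * r.
  rewrite -side E1_sym; congr (_ * _).
  under eq_mean => x do rewrite E1fd mulrBr -mulrN [X in _ + X]mulrC.
  by rewrite meanD meanZ mean_p mulr0 addr0.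
have [pE1|p0] := E1_ratio b c; last first.
  exists (r / al) => t; have := main t.
  rewrite (@eq_mean _ (fun=> 0)) ?mean_cst => [|x]; last by rewrite p0 mul0r.
  rewrite mulr0 => /esym/eqP; rewrite subr_eq0 => /eqP e.
  by apply: (mulfI al0); rewrite e /fk; field.
exists (r / ga) => t; have := main t.
rewrite (@eq_mean _ (fun x => h x * dev t (x k))) => [|x]; last first.
  by rewrite pE1 mulrA [_ * f x]mulrC fp.
rewrite -/(proj k h t) => e; apply: (mulfI ga0).
transitivity (fk t * r); last by rewrite /fk; field.
transitivity (al * proj k h t - (al - ga) * proj k h t); first by ring.
by rewrite e opprB addrC subrK.
Qed.

Lemma proj_sum (J : finType) k (r : J -> F) (phi : J -> word -> F) t :
  proj k (fun x => \sum_j r j * phi j x) t = \sum_j r j * proj k (phi j) t.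
Proof.
rewrite /proj; under eq_mean => x do rewrite mulr_suml.
by rewrite mean_sum; apply: eq_bigr => j _; exact: projZ.
Qed.

Lemma proj_delta k y t :
  proj k (fun x => (x == y)%:R) t = (q ^ n)%:R^-1 * dev t (y k).
Proof.
rewrite /proj /mean (bigD1 y) //= eqxx mul1r big1 ?addr0 // => x /negPf ->.
by rewrite mul0r.
Qed.

Lemma delta_ratio a y x :
  (x == y)%:R = \sum_c ((q ^ n)%:R^-1 / ratio a c y) * ratio a c x.
Proof.
transitivity (\sum_c (q ^ n)%:R^-1 * (W x a / W y a) * (W y c / W x c)).
  rewrite -mulr_sumr W_rows eq_sym; have [->|] := eqVneq x y.
    by rewrite divff // mulr1 mul1r mulVf.
  by rewrite mul0r mulr0.
apply: eq_bigr => c _; rewrite /ratio; field.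
by rewrite !W_neq0 qn_neq0.
Qed.

Hypothesis q_ge3 : (3 <= q)%N.

(** Expanding the indicator of a word [y] along the [ratio a c], it follows from
    [proj_ratio_prop] that its projection, a nonzero multiple of
    [dev ^~ (y k)], is a multiple of [fk].  The former takes equal values at any
    two letters other than [y k]; letting [y k] avoid two letters where [fk]
    differs, which is possible when there are three letters, gives a
    contradiction. *)
Lemma ratio_one_letter a b k l t0 s0 : E1 (ratio a b) =1 ratio a b -> k != l ->
  proj k (ratio a b) t0 != 0 -> proj l (ratio a b) s0 = 0.
Proof.
move=> fE kl fk0; apply/eqP/negPn/negP => fl0.
have /fin_all_exists[r rE] := proj_ratio_prop fE kl fk0 fl0.
have [t1 ft1] := avg0_neq (avg_proj k _) fk0.
have [t2] : exists t2, t2 \notin [set t0; t1].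
  apply/existsP; rewrite -negb_forall; apply/negP => /forallP all2.
  have : (#|'I_q| <= #|[set t0; t1]|)%N.
    by apply: subset_leq_card; apply/fintype.subsetP => t _; exact: all2.
  by rewrite card_ord cards2 leqNgt (leq_trans _ q_ge3) //; case: (_ != _).
rewrite !inE negb_or => /andP[t20 t21].
pose y : word := [ffun=> t2].
pose S := \sum_c (q ^ n)%:R^-1 / ratio a c y * r c.
have SE t : (q ^ n)%:R^-1 * dev t t2 = S * proj k (ratio a b) t.
  have -> : t2 = y k by rewrite ffunE.
  rewrite -proj_delta (eq_proj _ (delta_ratio a y)) proj_sum mulr_suml.
  by apply: eq_bigr => c _; rewrite rE mulrA.
have SN t : t2 != t -> S * proj k (ratio a b) t = - (q ^ n)%:R^-1.
  by move=> /negPf t2t; rewrite -SE /dev t2t mulr0 sub0r mulrN1.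
have S0 : S != 0.
  apply: contraTneq qn_neq0 => S0.
  by rewrite -invr_eq0 -oppr_eq0 -(SN t0 t20) S0 mul0r eqxx.
by case/eqP: ft1; apply: (mulfI S0); rewrite !SN.
Qed.

Lemma proj_ratio_eig k a b :
  exists lambda, forall x, proj k (ratio a b) (x k) = lambda * ratio a b x.
Proof.
have [fE|f0] := E1_ratio a b; last by exists 0 => x; rewrite mul0r proj_eq0.
have [/forallP fk0|] := boolP [forall t, proj k (ratio a b) t == 0].
  by exists 0 => x; rewrite mul0r; apply/eqP.
rewrite negb_forall => /existsP[t0 ft0]; exists 1 => x.
rewrite mul1r -[RHS]fE /E1 (bigD1 k) //= big1 ?addr0 // => l lk.
by apply: ratio_one_letter ft0; rewrite // eq_sym.
Qed.

End TypeIIWords.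
End Words.

(** * The Bose-Mesner algebra of the Hamming scheme *)

Section HammingKernels.
Variables (F : numFieldType) (n q : nat).
Hypothesis q_gt1 : (1 < q)%N.

Local Notation word := {ffun 'I_n -> 'I_q}.
Local Notation binword := {ffun 'I_n -> 'I_2}.
Implicit Types (x y : word) (i : binword) (c : binword -> F) (s : 'S_n).

Lemma word_index_inj m (x y : 'I_m -> 'I_q) :
  word_index x = word_index y -> x =1 y.
Proof.
elim: m x y => [|m IHm] x y; first by move=> _ [].
move=> /cast_ord_inj /(can_inj (@mxtens_indexK _ _)) [e0 /IHm e] k.
by case: (unliftP ord0 k) => [j ->|-> //]; exact: e.
Qed.

Lemma word_index_bij : bijective (fun x : word => word_index x).
Proof.
apply: inj_card_bij => [x y /word_index_inj /ffunP //|].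
by rewrite card_ffun !card_ord.
Qed.

Definition disagree x y : binword :=
  [ffun k => if x k == y k then ord0 else ord_max].

Lemma scheme_tensorE i x y :
  scheme_tensor F q i (word_index x) (word_index y) = (i == disagree x y)%:R.
Proof.
rewrite /scheme_tensor kronE.
have entry k :
    trivial_scheme F q (i k) (x k) (y k) = (i k == disagree x y k)%:R.
  rewrite ffunE /trivial_scheme.
  have [->|->] : i k = ord0 \/ i k = ord_max.
    case: (i k) => [[|[|//]] lt2]; [left|right]; exact: val_inj.
  - by rewrite eqxx mxE; case: (x k == y k).
  - by rewrite !mxE; case: (x k == y k); rewrite ?subrr ?subr0.
under eq_bigr => k _ do rewrite entry.
have [->|ni] := eqVneq i (disagree x y).
  by rewrite big1 // => k _; rewrite eqxx.
have [k nk] : exists k, i k != disagree x y k.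
  apply/existsP; rewrite -negb_forall; apply: contra ni => /forallP e.
  by apply/eqP/ffunP => k; apply/eqP.
by rewrite (bigD1 k) //= (negPf nk) mul0r.
Qed.

(** The matrix whose entry at a pair of words is [c] of the set of positions
    where they disagree; these matrices form the tensor power of the trivial
    scheme. *)
Definition disagreement_mx c : 'M[F]_(q ^ n) :=
  \sum_i c i *: scheme_tensor F q i.

Lemma disagreement_mxE c x y :
  disagreement_mx c (word_index x) (word_index y) = c (disagree x y).
Proof.
rewrite summxE (bigD1 (disagree x y)) //= big1 ?addr0 => [|i /negPf ni].
  by rewrite mxE scheme_tensorE eqxx mulr1.
by rewrite mxE scheme_tensorE ni mulr0.
Qed.

Lemma disagreement_mx_span c :
  disagreement_mx c \in <<scheme_tensors F q n>>%VS.
Proof.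
apply: memv_suml => i _; apply/memvZ/memv_span.
by rewrite -(enum_rankK i) -scheme_tensors_nth mem_nth // size_tuple.
Qed.

Lemma permute_wordK s : cancel (permute_word s) (permute_word (s^-1)%g).
Proof. by move=> i; apply/ffunP => k; rewrite !ffunE invgK permK. Qed.

Lemma sym_act_disagreement s c :
  sym_act s (disagreement_mx c) =
    disagreement_mx (fun i => c (permute_word (s^-1)%g i)).
Proof.
have permK' : cancel (permute_word (s^-1)%g) (@permute_word n s).
  by by move=> i; have := permute_wordK (s^-1)%g i; rewrite invgK.
rewrite /sym_act [RHS](reindex (permute_word s)) /=; last first.
  by exists (permute_word (s^-1)%g) => i _; [exact: permute_wordK | exact: permK'].
apply: eq_bigr => i _; rewrite permute_wordK; congr (_ *: _).
rewrite /disagreement_mx (reindex _ (onW_bij _ (@enum_val_bij binword))) /=.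
under eq_bigr => r _ do rewrite -scheme_tensors_nth.
by rewrite coord_sum_free ?scheme_tensors_free // enum_rankK.
Qed.

Lemma hamming_disagreement c : (forall s i, c (permute_word s i) = c i) ->
  hamming_bose_mesner F q n (disagreement_mx c).
Proof.
move=> cs; split; first exact: disagreement_mx_span.
by move=> s; rewrite sym_act_disagreement; apply: eq_bigr => i _; rewrite cs.
Qed.

Lemma mulmx_disagreement c (v : 'cV[F]_(q ^ n)) x :
  (disagreement_mx c *m v) (word_index x) 0 =
    \sum_(y : word) c (disagree x y) * v (word_index y) 0.
Proof.
rewrite mxE (reindex _ (onW_bij _ word_index_bij)) /=.
by apply: eq_bigr => y _; rewrite disagreement_mxE.
Qed.

Definition proj_coef k i : F :=
  (q ^ n)%:R^-1 * (q%:R * (i k == ord0)%:R - 1).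

Lemma mulmx_proj k (v : 'cV[F]_(q ^ n)) x :
  (disagreement_mx (proj_coef k) *m v) (word_index x) 0 =
    proj k (fun y => v (word_index y) 0) (x k).
Proof.
rewrite mulmx_disagreement /proj /mean mulr_sumr; apply: eq_bigr => y _.
rewrite /proj_coef /dev ffunE [y k == _]eq_sym.
by case: (x k == y k); rewrite /=; ring.
Qed.

Lemma mulmx_E1 (v : 'cV[F]_(q ^ n)) x :
  (disagreement_mx (fun i => \sum_k proj_coef k i) *m v) (word_index x) 0 =
    E1 (fun y => v (word_index y) 0) x.
Proof.
rewrite mulmx_disagreement.
under eq_bigr => y _ do rewrite mulr_suml.
rewrite exchange_big; apply: eq_bigr => k _ /=.
by rewrite -mulmx_proj mulmx_disagreement.
Qed.

Lemma hamming_E1 :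
  hamming_bose_mesner F q n (disagreement_mx (fun i => \sum_k proj_coef k i)).
Proof.
apply: hamming_disagreement => s i; rewrite (reindex_inj (@perm_inj _ s)) /=.
by apply: eq_bigr => k _; rewrite /proj_coef ffunE permK.
Qed.

(** The transposition of [k] and [l] moves [proj k] to [proj l]; they differ at
    a pair of words that agree at [k] and disagree at [l]. *)
Lemma hamming_projN k l : k != l ->
  ~ hamming_bose_mesner F q n (disagreement_mx (proj_coef k)).
Proof.
move=> kl [_ /(_ (tperm k l))]; rewrite sym_act_disagreement => /matrixP e.
pose t0 : 'I_q := Ordinal (ltnW q_gt1); pose t1 : 'I_q := Ordinal q_gt1.
pose x : word := [ffun=> t0].
pose y : word := [ffun j => if j == k then t0 else t1].
have := e (word_index x) (word_index y); rewrite !disagreement_mxE /proj_coef.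
rewrite !ffunE invgK tpermL ![l == k]eq_sym (negPf kl) !eqxx /=.
have qn0 : (q ^ n)%:R^-1 != 0 :> F.
  by rewrite invr_eq0 pnatr_eq0 -lt0n expn_gt0 (ltnW q_gt1).
move=> /(mulfI qn0)/addIr/eqP; rewrite mulr0 mulr1 eq_sym pnatr_eq0.
by rewrite gtn_eqF // ltnW.
Qed.

End HammingKernels.

(** The defining identity of a type II matrix inverts a square matrix, so it
    also holds for rows. *)
Lemma type_II_rows (F : fieldType) v (W : 'M[F]_v) : v%:R != 0 :> F ->
  type_II W -> forall x y, \sum_a W x a / W y a = (x == y)%:R * v%:R.
Proof.
move=> v0 [_ Wcols] x y.
pose N := \matrix_(x, a) (W x a)^-1.
have NW : (v%:R^-1 *: N^T) *m W = 1%:M.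
  apply/matrixP => b a; rewrite -scalemxAl !mxE.
  under eq_bigr => z _ do rewrite !mxE mulrC.
  by rewrite Wcols eq_sym mulrC mulfK.
have /matrixP/(_ x y) := mulmx1C NW; rewrite -scalemxAr !mxE => <-.
by rewrite mulrC mulVKf //; apply: eq_bigr => a _; rewrite !mxE.
Qed.

Theorem corollary5p6 (R : realType) (n q : nat)
    (hn : (2 <= n)%N) (hq : (3 <= q)%N) :
  ~ exists W : 'M[R[i]]_(q ^ n),
      type_II W /\ nomura_algebra W = hamming_bose_mesner R[i] q n.
Proof.
move=> [W [W2 NW]].
have q_gt0 : (0 < q)%N by exact: leq_trans hq.
have q_gt1 : (1 < q)%N by exact: leq_trans hq.
have qn0 : (q ^ n)%:R != 0 :> R[i].
  by rewrite pnatr_eq0 -lt0n expn_gt0 q_gt0.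
have [W0 Wcols] := W2; have Wrows := type_II_rows qn0 W2.
pose U (x : {ffun 'I_n -> 'I_q}) a := W (word_index x) a.
have U_cols a b : mean (fun x => U x a / U x b) = (a == b)%:R.
  rewrite /mean -[RHS](mulfK qn0) -Wcols mulrC.
  by rewrite (reindex _ (onW_bij _ (word_index_bij n q))).
have U_rows x y : \sum_a U x a / U y a = (x == y)%:R * (q ^ n)%:R.
  by rewrite Wrows (inj_eq (bij_inj (word_index_bij n q))).
have vecE a b (x : {ffun _}) :
    nomura_vector W a b (word_index x) 0 = ratio U a b x.
  by rewrite mxE.
have U_eig a b : exists la, forall x, E1 (ratio U a b) x = la * ratio U a b x.
  have := @hamming_E1 R[i] n q q_gt1; rewrite -NW.
  case/(_ a b) => _ [la e]; exists la => x.
  have /matrixP/(_ (word_index x) 0) := e.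
  rewrite mulmx_E1 mxE vecE => <-; exact/eq_E1.
pose k0 : 'I_n := Ordinal (ltnW hn); pose k1 : 'I_n := Ordinal hn.
apply: (@hamming_projN R[i] n q q_gt1 k0 k1) => //; rewrite -NW => a b.
split.
  apply/eqP => /matrixP/(_ (word_index [ffun=> Ordinal q_gt0]) 0)/eqP.
  by rewrite vecE mxE mulf_eq0 invr_eq0 !(negPf (W0 _ _)).
have [la e] := proj_ratio_eig q_gt0 (fun x a => W0 (word_index x) a) U_cols U_rows
  U_eig hq k0 a b.
exists la; apply/matrixP => j z; rewrite (ord1 z).
have [g _ gK] := word_index_bij n q; rewrite -(gK j) mulmx_proj mxE vecE -e.
exact/eq_proj.
Qed.
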